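(* Let $K$ be a field and let $T=K[x_{11},\dots,x_{1m_1},x_{21},\dots,x_{2m_2}]$ with $m_1,m_2>1$. Let $L=\sum_{j=1}^m L_{1,a_j}L_{2,b_j}\subset T$ (the generalized mixed product ideal induced by $I=(x^{a_1}y^{b_1},\dots,x^{a_m}y^{b_m})$), where the ideals $L_{1,a_j}$ in $K[x_{11},\dots,x_{1m_1}]$ and the ideals $L_{2,b_j}$ in $K[x_{21},\dots,x_{2m_2}]$ are squarefree Veronese ideals of degree $a_j$ and $b_j$, respectively. Assume that $a_m>\dots>a_1=1$, $b_1>\dots>b_m=1$ and $m>1$. If (1) $a_{j+1}=a_j+1$ for all $j=1,\dots,m-1$ and $b_{j-1}=b_j+1$ for all $j=2,\dots,m$, and (2) there is an integer $z$ with $2<z\le m_1+m_2-1$ such that $a_j+b_j=z$ for all $j=1,\dots,m$, then the Castelnuovo-Mumford regularity of $T/L$ equals $z-1$.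
   Context: The squarefree Veronese ideal of degree $a$ in a polynomial ring is generated by all squarefree monomials of degree $a$ in its variables. Sums and products are formed in $T$ after extending the ideals to $T$. The Castelnuovo-Mumford regularity of $T/L$ is $\max\{j-i:\beta_{i,j}(T/L)\ne 0\}$, where $\beta_{i,j}(T/L)$ are the graded Betti numbers of the minimal graded free resolution of $T/L$ over $T$ (each variable has degree $1$). *)

(* Defs.v *)
From HB Require Import structures.
From mathcomp Require Import all_boot all_order all_algebra.
From mathcomp Require Import mpoly.

Set Implicit Arguments.
Unset Strict Implicit.
Unset Printing Implicit Defensive.

Import Order.TTheory GRing.Theory Num.Theory.
Local Open Scope ring_scope.

Definition ideal_gen (R : comNzRingType) (S : R -> Prop) : R -> Prop :=
  fun x => exists (k : nat) (c s : 'I_k -> R),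
    (forall i, S (s i)) /\ x = \sum_(i < k) c i * s i.

Definition ideal_mul (R : comNzRingType) (I J : R -> Prop) : R -> Prop :=
  ideal_gen (fun z => exists x y, [/\ I x, J y & z = x * y]).

(* The sum I_1 + ... + I_m, indexed from 1. *)
Definition ideal_sum (R : comNzRingType) (m : nat) (I : nat -> R -> Prop) :
    R -> Prop :=
  fun x => exists s : nat -> R,
    (forall j, (1 <= j <= m)%N -> I j (s j)) /\ x = \sum_(1 <= j < m.+1) s j.

Definition ideal_ext (R S : comNzRingType) (f : R -> S) (I : R -> Prop) :
    S -> Prop :=
  ideal_gen (fun y => exists2 x, I x & y = f x).

(* The zero ideal when n < a. *)
Definition sqfree_veronese (K : fieldType) (n a : nat) : {mpoly K[n]} -> Prop :=
  ideal_gen (fun p => exists2 A : {set 'I_n}, #|A| = a & p = \prod_(i in A) 'X_i).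

(* In K[x_11..x_1m1, x_21..x_2m2] the first m1 variables are the x_1i and the
   last m2 variables are the x_2i. *)
Definition incl1 (K : fieldType) (m1 m2 : nat) (p : {mpoly K[m1]}) :
    {mpoly K[m1 + m2]} :=
  p \mPo [tuple 'X_(lshift m2 i) | i < m1].

Definition incl2 (K : fieldType) (m1 m2 : nat) (p : {mpoly K[m2]}) :
    {mpoly K[m1 + m2]} :=
  p \mPo [tuple 'X_(rshift m1 i) | i < m2].

Definition mixed_product_ideal (K : fieldType) (m1 m2 m : nat) (a b : nat -> nat) :
    {mpoly K[m1 + m2]} -> Prop :=
  ideal_sum m (fun j =>
    ideal_mul (ideal_ext (@incl1 K m1 m2) (@sqfree_veronese K m1 (a j)))
              (ideal_ext (@incl2 K m1 m2) (@sqfree_veronese K m2 (b j)))).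

(* p lies in the degree-e component of the polynomial ring (which is 0 if e < 0). *)
Definition in_degree (K : fieldType) (n : nat) (e : int) (p : {mpoly K[n]}) : Prop :=
  match e with
  | Posz d => p \is d.-homog
  | Negz _ => p = 0
  end.

(* The data of a sequence of finitely generated graded free T-modules
     ... -> F_2 -> F_1 -> F_0 -> T/L -> 0,   F_i = (+)_p T(- fr_shift i p).
   Elements of F_i are row vectors and maps act by right multiplication;
   fr_diff i is F_{i+1} -> F_i, and fr_aug lists lifts to T of the images in T/L
   of the basis of F_0. *)
Record free_cplx (K : fieldType) (n : nat) := FreeCplx {
  fr_rank : nat -> nat;
  fr_shift : forall i, 'I_(fr_rank i) -> int;
  fr_diff : forall i, 'M[{mpoly K[n]}]_(fr_rank i.+1, fr_rank i);
  fr_aug : 'cV[{mpoly K[n]}]_(fr_rank 0)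
}.

Definition graded_cplx (K : fieldType) (n : nat) (F : free_cplx K n) : Prop :=
  (forall p, in_degree (fr_shift p) (fr_aug F p 0)) /\
  (forall i p q, in_degree (fr_shift p - fr_shift q) (fr_diff F i p q)).

Definition resolves (K : fieldType) (n : nat) (L : {mpoly K[n]} -> Prop)
    (F : free_cplx K n) : Prop :=
  [/\ forall f, exists u : 'rV_(fr_rank F 0), L (f - (u *m fr_aug F) 0 0),
      forall u : 'rV_(fr_rank F 0),
        L ((u *m fr_aug F) 0 0) <-> exists w, u = w *m fr_diff F 0
    & forall i (u : 'rV_(fr_rank F i.+1)),
        u *m fr_diff F i = 0 <-> exists w, u = w *m fr_diff F i.+1].

(* Each differential has image in (x_1, ..., x_n) F_i. *)
Definition minimal_cplx (K : fieldType) (n : nat) (F : free_cplx K n) : Prop :=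
  forall i p q, (fr_diff F i p q)@_0%MM = 0.

Definition minimal_graded_free_resolution (K : fieldType) (n : nat)
    (L : {mpoly K[n]} -> Prop) (F : free_cplx K n) : Prop :=
  [/\ graded_cplx F, resolves L F & minimal_cplx F].

Definition graded_betti (K : fieldType) (n : nat) (F : free_cplx K n)
    (i : nat) (j : int) : nat :=
  #|[set p : 'I_(fr_rank F i) | fr_shift p == j]|.

Definition max_betti_shift (K : fieldType) (n : nat) (F : free_cplx K n)
    (r : int) : Prop :=
  (exists i j, graded_betti F i j <> 0%N /\ j - i%:Z = r) /\
  (forall i j, graded_betti F i j <> 0%N -> j - i%:Z <= r).

(* reg (T/L) = r.  The resolution is unique up to isomorphism, so the two
   conjuncts together make r the value on "the" minimal resolution. *)
Definition CM_regularity (K : fieldType) (n : nat) (L : {mpoly K[n]} -> Prop)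
    (r : int) : Prop :=
  (exists F, minimal_graded_free_resolution L F) /\
  (forall F, minimal_graded_free_resolution L F -> max_betti_shift F r).

(* Main.v *)
(* The hypotheses force a_j = j and b_j = z - j, so L is generated by the
   squarefree monomials of degree z involving both groups of variables. Their
   supports are the bases of a matroid, so in lexicographic order L has linear
   quotients: each colon ideal of the previous generators by the next one is
   generated by variables. Gluing the resolutions of these quotients by the
   horseshoe lemma gives a linear resolution of L. A comparison argument shows
   that any minimal graded resolution of T/L has the same shifts, so the
   regularity is z - 1. *)
From HB Require Import structures.
Require Import Defs.
From mathcomp Require Import all_boot all_order all_algebra.
From mathcomp Require Import mpoly zify.
From Stdlib Require Import IndefiniteDescription.
Set Implicit Arguments.
Unset Strict Implicit.
Unset Printing Implicit Defensive.
Import Order.TTheory GRing.Theory Num.Theory.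
Local Open Scope ring_scope.

(** * Comparison of minimal graded resolutions *)

(** The regularity is a statement about every minimal graded resolution, so exhibiting one linear
    resolution does not settle it. The comparison yields, for any two minimal resolutions [F] and
    [G], that each shift in position [i] of [F] occurs in position [i] of [G]; used in both
    directions, this fixes the maximum of [j - i]. It works because the composite of the comparison
    maps differs from the identity only by terms containing a differential, and these have no
    constant terms by minimality.

    Resolutions are infinite sequences of matrices. Linearity is therefore a coinductive property,
    and the horseshoe lemma is a corecursion on it. The value [z - 1] appears because the free
    module in position [i >= 1] of the linear resolution has all its shifts equal to [z + i - 1];
    since [L] is nonzero, position 1 is not empty and the value is attained. *)

Lemma rows_in_image (R : comNzRingType) r s t (A : 'M[R]_(r, s)) (D : 'M_(t, s)) :
  (forall i, exists w : 'rV_t, row i A = w *m D) -> exists W, A = W *m D.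
Proof.
move=> /fin_all_exists [w wP]; exists (\matrix_i w i).
by apply/row_matrixP => i; rewrite row_mul rowK.
Qed.

Section HomogeneousComponent.
Variables (K : fieldType) (n : nat).
Local Notation T := {mpoly K[n]}.

(** Degrees are integers because they arise as differences of shifts; the negative case matches
    [in_degree]. *)
Definition hcomp (e : int) (p : T) : T :=
  if e is Posz d then pihomog mdeg d p else 0.

Lemma hcomp_is_linear e : linear (hcomp e).
Proof. by case: e => d c p q; rewrite /hcomp ?linearP // scaler0 addr0. Qed.

HB.instance Definition _ e :=
  GRing.isLinear.Build K T T _ (hcomp e) (hcomp_is_linear e).

Lemma hcompP e p : in_degree e (hcomp e p).
Proof. by case: e => d //; apply: pihomogP. Qed.

Lemma hcomp_id e p : in_degree e p -> hcomp e p = p.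
Proof. by case: e => d //=; apply: pihomog_dE. Qed.

Lemma hcompX e m : hcomp e 'X_[m] = if (mdeg m)%:Z == e then 'X_[m] else 0.
Proof. by case: e => d //=; rewrite pihomogX. Qed.

Lemma hcomp_homog e (d : nat) p :
  p \is d.-homog -> hcomp e p = if d%:Z == e then p else 0.
Proof.
case: e => k hp //=; rewrite eqz_nat; case: eqVneq => [<-|ne]; first exact: pihomog_dE.
exact: pihomog_ne0 ne hp.
Qed.

Lemma hcompMr e f p q : in_degree f q -> hcomp (e + f) (p * q) = hcomp e p * q.
Proof.
case: f => d /= hq; last by rewrite hq !mulr0 linear0.
rewrite [p]mpolyE mulr_suml !linear_sum mulr_suml; apply: eq_bigr => t _ /=.
rewrite -scalerAl !linearZ /= -scalerAl; congr (_ *: _).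
have hX : 'X_[K, t] * q \is (mdeg t + d)%N.-homog by rewrite dhomogM ?dhomogX.
by rewrite (hcomp_homog _ hX) hcompX PoszD (inj_eq (addIr _)); case: eqP; rewrite ?mul0r.
Qed.

(** Keep in each entry of [W] only the component of the required degree. Taking components commutes
    with multiplication by the homogeneous entries of [D], and [X] is unchanged by it. *)
Lemma graded_lift r s t (al : 'I_r -> int) (be : 'I_s -> int) (ga : 'I_t -> int)
    (X : 'M[T]_(r, t)) (D : 'M_(s, t)) :
  (forall p q, in_degree (al p - ga q) (X p q)) ->
  (forall p q, in_degree (be p - ga q) (D p q)) ->
  (exists W, X = W *m D) ->
  exists2 W : 'M_(r, s), X = W *m D & forall p q, in_degree (al p - be q) (W p q).
Proof.
move=> hX hD [W eX]; exists (\matrix_(p, q) hcomp (al p - be q) (W p q)); last first.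
  by move=> p q; rewrite mxE; apply: hcompP.
apply/matrixP => p q; rewrite -(hcomp_id (hX p q)) eX !mxE linear_sum /=.
apply: eq_bigr => i _; rewrite mxE -(hcompMr _ _ (hD i q)); congr hcomp.
by rewrite addrA subrK.
Qed.

Lemma in_degreeM e f (p q : T) : in_degree e p -> in_degree f q -> in_degree (e + f) (p * q).
Proof. by move=> /hcomp_id <- hq; rewrite -(hcompMr _ _ hq); apply: hcompP. Qed.

Lemma in_degree_sum I (r : seq I) e (F : I -> T) :
  (forall i, in_degree e (F i)) -> in_degree e (\sum_(i <- r) F i).
Proof.
move=> h; rewrite (eq_bigr (fun i => hcomp e (F i))); last by move=> i _; rewrite hcomp_id.
by rewrite -linear_sum; apply: hcompP.
Qed.

Lemma in_degree_mulmx r s t (al : 'I_r -> int) (be : 'I_s -> int) (ga : 'I_t -> int)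
    (A : 'M[T]_(r, s)) (B : 'M_(s, t)) :
  (forall p q, in_degree (al p - be q) (A p q)) ->
  (forall p q, in_degree (be p - ga q) (B p q)) ->
  forall p q, in_degree (al p - ga q) ((A *m B) p q).
Proof.
move=> hA hB p q; rewrite mxE; apply: in_degree_sum => i.
have -> : al p - ga q = (al p - be i) + (be i - ga q) by rewrite addrA subrK.
exact: in_degreeM.
Qed.

Lemma mcoeff0_in_degree e (p : T) : in_degree e p -> p@_0%MM != 0 -> e = 0.
Proof.
case: e => d /= hp; last by rewrite hp mcoeff0 eqxx.
by rewrite -mcoeff_msupp => /(dhomog_mf hp) /=; rewrite mdeg0 => <-.
Qed.

End HomogeneousComponent.

Section Comparison.
Variables (K : fieldType) (n : nat).
Local Notation T := {mpoly K[n]}.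

Definition homogeneous_ideal (L : T -> Prop) : Prop :=
  [/\ L 0, forall p q, L p -> L q -> L (p + q), forall c p, L p -> L (c * p)
    & forall e p, L p -> L (hcomp e p)].

Variable L : T -> Prop.
Hypothesis idL : homogeneous_ideal L.

Let LN p : L p -> L (- p).
Proof. by case: idL => _ _ LM _; rewrite -mulN1r; apply: LM. Qed.

Let Lsum I (r : seq I) (F : I -> T) : (forall i, L (F i)) -> L (\sum_(i <- r) F i).
Proof. by case: idL => L0 LD _ _ h; apply: big_ind. Qed.

Let Lmx r s t (W : 'M[T]_(r, s)) (A : 'M_(s, t)) :
  (forall i j, L (A i j)) -> forall i j, L ((W *m A) i j).
Proof.
by case: idL => _ _ LM _ h i j; rewrite mxE; apply: Lsum => k; apply: LM.
Qed.

Local Notation const_mx_of A := (map_mx (mcoeff 0%MM) A).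

Section Stage.
Variables F G : free_cplx K n.
Hypothesis hF : minimal_graded_free_resolution L F.
Hypothesis hG : minimal_graded_free_resolution L G.

Let dd (H : free_cplx K n) (hH : resolves L H) i : fr_diff H i.+1 *m fr_diff H i = 0.
Proof.
case: hH => _ _ ex; apply/row_matrixP => p; rewrite row_mul row0.
by apply/ex; exists (delta_mx 0 p); rewrite rowE.
Qed.

Let exact_lift (H : free_cplx K n) (hH : resolves L H) i r
    (A : 'M[T]_(r, fr_rank H i.+1)) :
  A *m fr_diff H i = 0 -> exists W, A = W *m fr_diff H i.+1.
Proof.
case: hH => _ _ ex hA; apply: rows_in_image => p.
by apply/ex; rewrite -row_mul hA row0.
Qed.

Let exact_lift0 (H : free_cplx K n) (hH : resolves L H) r
    (A : 'M[T]_(r, fr_rank H 0)) :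
  (forall p q, L ((A *m fr_aug H) p q)) -> exists W, A = W *m fr_diff H 0.
Proof.
case: hH => _ ex _ hA; apply: rows_in_image => p.
by apply/ex; rewrite -row_mul mxE; apply: hA.
Qed.

Let aug_lift (H : free_cplx K n) (hH : resolves L H) r (A : 'M[T]_(r, 1)) :
  exists W, forall p q, L ((A - W *m fr_aug H) p q).
Proof.
case: hH => sj _ _.
have /fin_all_exists [w wP] :
    forall p, exists u : 'rV_(fr_rank H 0), L (A p 0 - (u *m fr_aug H) 0 0).
  by move=> p; apply: sj.
exists (\matrix_p w p) => p q; move: (wP p); rewrite !mxE (ord1 q).
by under [X in _ -> L (_ - X)]eq_bigr do rewrite mxE.
Qed.

Let diff_aug (H : free_cplx K n) (hH : resolves L H) p q : L ((fr_diff H 0 *m fr_aug H) p q).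
Proof.
case: hH => _ ex _; rewrite (ord1 q).
have /ex : exists w, row p (fr_diff H 0) = w *m fr_diff H 0.
  by exists (delta_mx 0 p); rewrite rowE.
by rewrite -row_mul mxE.
Qed.

Let const_diffl (H : free_cplx K n) (hH : minimal_cplx H) i r
    (W : 'M[T]_(r, fr_rank H i.+1)) : const_mx_of (W *m fr_diff H i) = 0.
Proof.
apply/matrixP => p q; rewrite map_mxM [X in _ *m X](_ : _ = 0) ?mulmx0 //.
by apply/matrixP => p' q'; rewrite !mxE; apply: hH.
Qed.

Let const_diffr (H : free_cplx K n) (hH : minimal_cplx H) i r
    (W : 'M[T]_(fr_rank H i, r)) : const_mx_of (fr_diff H i *m W) = 0.
Proof.
apply/matrixP => p q; rewrite map_mxM [X in X *m _](_ : _ = 0) ?mul0mx //.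
by apply/matrixP => p' q'; rewrite !mxE; apply: hH.
Qed.

(* Stage [i] of two comparison maps [phi : F -> G], [psi : G -> F] and of a
   homotopy [h] from [phi psi] to the identity, with exactly the conditions that
   allow stage [i + 1] to be constructed. *)
Definition comparison_stage i : Prop :=
  exists (phi : 'M[T]_(fr_rank F i, fr_rank G i))
         (psi : 'M[T]_(fr_rank G i, fr_rank F i))
         (h : 'M[T]_(fr_rank F i, fr_rank F i.+1)),
  [/\ forall p q, in_degree (fr_shift p - fr_shift q) (phi p q),
      exists N, fr_diff F i *m phi = N *m fr_diff G i,
      exists N, fr_diff G i *m psi = N *m fr_diff F i,
      fr_diff F i *m (phi *m psi - 1%:M - h *m fr_diff F i) = 0
    & const_mx_of (phi *m psi) = 1%:M].

(** The augmentations are matched only modulo [L]. Truncating a lift to the required degrees keeps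
    it a lift because [L] is homogeneous. Both [phi psi] and the identity lift [fr_aug F], so
    exactness gives [h]. *)
Lemma comparison_stage0 : comparison_stage 0.
Proof.
have [L0 LD LM Lh] := idL; have [[aF gF] rF mF] := hF; have [[aG gG] rG mG] := hG.
have [phi0 hphi0] := aug_lift rG (fr_aug F).
pose phi : 'M[T]_(fr_rank F 0, fr_rank G 0) :=
  \matrix_(p, q) hcomp (fr_shift p - fr_shift q) (phi0 p q).
have hphi p q : L ((fr_aug F - phi *m fr_aug G) p q).
  rewrite (ord1 q); have := Lh (fr_shift p) _ (hphi0 p 0).
  rewrite !mxE linearB linear_sum /= (hcomp_id (aF p)).
  rewrite (eq_bigr (fun i => phi p i * fr_aug G i 0)) // => i _.
  by rewrite mxE -(hcompMr _ _ (aG i)) subrK.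
have [psi hpsi] := aug_lift rF (fr_aug G).
have [h eh] : exists h, phi *m psi - 1%:M = h *m fr_diff F 0.
  apply: exact_lift0 => // p q.
  rewrite (_ : _ *m _ = - (phi *m (fr_aug G - psi *m fr_aug F)) - (fr_aug F - phi *m fr_aug G)).
    by rewrite mxE; apply: LD; rewrite mxE; apply: LN => //; apply: Lmx.
  rewrite mulmxBl mul1mx -mulmxA mulmxBr opprB opprB addrA.
  by rewrite subrK.
exists phi, psi, h; split.
- by move=> p q; rewrite mxE; apply: hcompP.
- apply: exact_lift0 => // p q.
  rewrite (_ : _ *m _ *m _ = fr_diff F 0 *m fr_aug F - fr_diff F 0 *m (fr_aug F - phi *m fr_aug G)).
    by rewrite mxE; apply: LD; [apply: diff_aug|rewrite mxE; apply: LN; apply: Lmx].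
  by rewrite mulmxBr opprB addrC subrK mulmxA.
- apply: exact_lift0 => // p q.
  rewrite (_ : _ *m _ *m _ = fr_diff G 0 *m fr_aug G - fr_diff G 0 *m (fr_aug G - psi *m fr_aug F)).
    by rewrite mxE; apply: LD; [apply: diff_aug|rewrite mxE; apply: LN; apply: Lmx].
  by rewrite mulmxBr opprB addrC subrK mulmxA.
- by rewrite eh subrr mulmx0.
- move/eqP: eh; rewrite subr_eq => /eqP ->.
  by rewrite map_mxD const_diffl // add0r map_mx1.
Qed.

(** At the new stage [phi' psi' - 1] is [h' d + d h], with [h] the old homotopy. Precomposing with
    the next differential kills [d h], so the stage condition needs to mention [h'] only; and both
    terms contain a differential, so they have no constant terms. *)
Lemma comparison_stageS i : comparison_stage i -> comparison_stage i.+1.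
Proof.
have [[aF gF] rF mF] := hF; have [[aG gG] rG mG] := hG.
move=> [phi [psi [h [gphi ephi [psi' epsi] eh _]]]].
have [phi' ephi' gphi'] :=
  graded_lift (in_degree_mulmx (gF i) gphi) (gG i) ephi.
have [h' eh'] : exists h', phi' *m psi' - 1%:M - fr_diff F i *m h = h' *m fr_diff F i.+1.
  apply: exact_lift => //; rewrite !mulmxBl mul1mx -mulmxA -epsi mulmxA -ephi'.
  by rewrite -[X in _ = X]eh !mulmxBr mulmx1 !mulmxA.
exists phi', psi', h'; split => //.
- by apply: exact_lift => //; rewrite -mulmxA -ephi' mulmxA dd // mul0mx.
- by apply: exact_lift => //; rewrite -mulmxA -epsi mulmxA dd // mul0mx.
- by rewrite -eh' opprB addrCA subrr addr0 mulmxA dd // mul0mx.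
- have -> : phi' *m psi' = h' *m fr_diff F i.+1 + fr_diff F i *m h + 1%:M.
    by rewrite -eh' subrK subrK.
  by rewrite !map_mxD const_diffl // const_diffr // !add0r map_mx1.
Qed.

(** Row [p] of the constant part of [phi] is nonzero, since its product with that of [psi] is a row
    of the identity. A nonzero constant term in an entry of degree [fr_shift p - fr_shift q] forces
    this degree to be 0. *)
Lemma minimal_resolution_shift i (p : 'I_(fr_rank F i)) :
  exists q : 'I_(fr_rank G i), fr_shift p = fr_shift q.
Proof.
have [phi [psi [h [gphi _ _ _ e1]]]] : comparison_stage i.
  by elim: i {p} => [|i IH]; [apply: comparison_stage0 | apply: comparison_stageS].
have [q hq] : exists q, (phi p q)@_0%MM != 0.
  apply/existsP; apply: contraT; rewrite negb_exists => /forallP h0.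
  have /eqP := congr1 (fun M : 'M_ _ => M p p) e1.
  rewrite map_mxM !mxE eqxx big1 ?(eq_sym 0) ?oner_eq0 // => q _.
  by rewrite !mxE; have := h0 q; rewrite negbK => /eqP hq; rewrite [X in X * _]hq mul0r.
by exists q; apply/eqP; rewrite -subr_eq0; apply/eqP; apply: mcoeff0_in_degree (gphi p q) hq.
Qed.

End Stage.
End Comparison.

(** * Linear resolutions *)

Section Linear.
Variables (K : fieldType) (n : nat).
Local Notation T := {mpoly K[n]}.

Definition homog_mx (d : nat) r s (A : 'M[T]_(r, s)) : Prop :=
  forall p q, A p q \is d.-homog.

Lemma homog_mx_lift d r s t (X : 'M[T]_(r, t)) (D : 'M_(s, t)) :
  homog_mx d.+1 X -> homog_mx d D -> (exists W, X = W *m D) ->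
  exists2 W : 'M_(r, s), X = W *m D & homog_mx 1 W.
Proof.
move=> hX hD eX.
have := @graded_lift K n r s t (fun=> d.+1%:Z) (fun=> d%:Z) (fun=> 0) X D _ _ eX.
case=> [p q|p q|W eW hW]; [by rewrite subr0; apply: hX|by rewrite subr0; apply: hD|].
by exists W => // p q; have := hW p q; rewrite -addn1 PoszD addrAC subrr add0r.
Qed.

Lemma homog_mulmx d e r s t (A : 'M[T]_(r, s)) (B : 'M_(s, t)) :
  homog_mx d A -> homog_mx e B -> homog_mx (d + e) (A *m B).
Proof. by move=> hA hB p q; rewrite mxE rpred_sum // => i _; apply: dhomogM. Qed.

Lemma homog_oppmx d r s (A : 'M[T]_(r, s)) : homog_mx d A -> homog_mx d (- A).
Proof. by move=> hA p q; rewrite mxE rpredN. Qed.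

Lemma homog_block_mx d r1 r2 s1 s2 (A : 'M[T]_(r1, s1)) (C : 'M_(r2, s1)) (B : 'M_(r2, s2)) :
  homog_mx d A -> homog_mx d C -> homog_mx d B -> homog_mx d (block_mx A 0 C B).
Proof.
move=> hA hC hB p q; rewrite -(splitK p) -(splitK q).
by case: (split p) => i; case: (split q) => j /=;
  rewrite ?block_mxEul ?block_mxEur ?block_mxEdl ?block_mxEdr // mxE rpred0.
Qed.

Definition syzygies r s r' (A : 'M[T]_(r, s)) (B : 'M_(r', r)) : Prop :=
  forall u : 'rV_r, u *m A = 0 <-> exists w, u = w *m B.

(* The kernel of [A] has a free resolution all of whose maps, including the
   inclusion into the source of [A], have linear entries. *)
CoInductive lin_res r s (A : 'M[T]_(r, s)) : Prop :=
  LinRes r' (B : 'M_(r', r)) of homog_mx 1 B & syzygies A B & lin_res B.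

Lemma lin_res_next r s (A : 'M[T]_(r, s)) : lin_res A ->
  exists r' (B : 'M_(r', r)), [/\ homog_mx 1 B, syzygies A B & lin_res B].
Proof. by case=> r' B hB sB lB; exists r', B. Qed.

Lemma syzygies_mul0 r s r' (A : 'M[T]_(r, s)) (B : 'M_(r', r)) :
  syzygies A B -> B *m A = 0.
Proof.
move=> h; apply/row_matrixP => p; rewrite row_mul row0.
by apply/h; exists (delta_mx 0 p); rewrite rowE.
Qed.

(** A kernel vector [(u1, u2)] has [u2 = w2 B'], and the condition on [C'] then puts [u1 - w2 C'] in
    the kernel of [A]. *)
Lemma syzygies_block r1 r2 s1 s2 r1' r2' (A : 'M[T]_(r1, s1)) (C : 'M_(r2, s1))
    (B : 'M_(r2, s2)) (A' : 'M_(r1', r1)) (B' : 'M_(r2', r2)) (C' : 'M_(r2', r1)) :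
  syzygies A A' -> syzygies B B' -> C' *m A = - (B' *m C) ->
  syzygies (block_mx A 0 C B) (block_mx A' 0 C' B').
Proof.
move=> sA sB eC u; split=> [|[w ->]].
  rewrite -[u]hsubmxK mul_row_block mulmx0 add0r -row_mx0.
  case/eq_row_mx => e1 /sB [w2 e2].
  have /sA [w1 e3] : (lsubmx u - w2 *m C') *m A = 0.
    by rewrite mulmxBl -mulmxA eC mulmxN opprK mulmxA -e2.
  exists (row_mx w1 w2); rewrite mul_row_block mulmx0 add0r -e2 -e3.
  by rewrite subrK.
rewrite -mulmxA mulmx_block !(syzygies_mul0 sA, syzygies_mul0 sB) !mulmx0 !mul0mx !addr0 eC.
by rewrite addNr block_mx0 mulmx0.
Qed.

(* The hypothesis on [v] says that the syzygies of the block matrix surject onto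
   those of [B]; it is what makes them of the same block form. *)
Lemma syzygies_block_step d r1 r2 s1 s2 r1' r2' (A : 'M[T]_(r1, s1)) (C : 'M_(r2, s1))
    (B : 'M_(r2, s2)) (A' : 'M_(r1', r1)) (B' : 'M_(r2', r2)) :
  homog_mx d A -> homog_mx d C ->
  (forall v : 'rV_r2, v *m B = 0 -> exists u, u *m A + v *m C = 0) ->
  syzygies A A' -> homog_mx 1 B' -> syzygies B B' ->
  exists C' : 'M_(r2', r1),
    [/\ homog_mx 1 C', syzygies (block_mx A 0 C B) (block_mx A' 0 C' B')
      & forall v : 'rV_r2', v *m B' = 0 -> exists u, u *m A' + v *m C' = 0].
Proof.
move=> hA hC surj sA hB' sB.
have [C' eC hC'] : exists2 C', - (B' *m C) = C' *m A & homog_mx 1 C'.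
  apply: (@homog_mx_lift d) => //.
    by apply: homog_oppmx; rewrite -add1n; apply: homog_mulmx.
  apply: rows_in_image => p.
  have /surj [u hu] : row p B' *m B = 0 by rewrite -row_mul (syzygies_mul0 sB) row0.
  by exists u; move/eqP: hu; rewrite addr_eq0 -row_mul => /eqP ->; rewrite raddfN.
exists C'; split=> [//||v hv]; first exact: syzygies_block sA sB (esym eC).
have /sA [w hw] : (v *m C') *m A = 0.
  by rewrite -mulmxA -eC mulmxN mulmxA hv mul0mx oppr0.
by exists (- w); rewrite hw mulNmx addNr.
Qed.

(* The horseshoe lemma: the resolution is built one block matrix at a time. *)
Lemma lin_res_block d r1 r2 s1 s2 (A : 'M[T]_(r1, s1)) (C : 'M_(r2, s1)) (B : 'M_(r2, s2)) :
  homog_mx d A -> homog_mx d C ->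
  (forall v : 'rV_r2, v *m B = 0 -> exists u, u *m A + v *m C = 0) ->
  lin_res A -> lin_res B -> lin_res (block_mx A 0 C B).
Proof.
(* The degree is generalised as well: it is [d] for the given [A] and [C], but 1 at every later
   stage. *)
move: d r1 r2 s1 s2 A C B; cofix IH => d r1 r2 s1 s2 A C B hA hC surj.
case=> r1' A' hA' sA lA' [r2' B' hB' sB lB'].
case: (syzygies_block_step hA hC surj sA hB' sB) => C' [hC' sb surj'].
exact: LinRes (homog_block_mx hA' hC' hB') sb (IH 1%N _ _ _ _ _ _ _ hA' hC' surj' lA' lB').
Qed.

(** The column [A] lists generators of [I], so this resolves [I] itself and not the quotient; no
    generators are allowed, which covers the zero ideal. *)
Definition has_lin_res (d : nat) (I : T -> Prop) : Prop :=
  exists r (A : 'M[T]_(r, 1)), [/\ homog_mx d A, lin_res A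
    & forall f, I f <-> exists u : 'rV_r, f%:M = u *m A].

Lemma has_lin_res_ext d (I J : T -> Prop) :
  (forall f, I f <-> J f) -> has_lin_res d I -> has_lin_res d J.
Proof.
by move=> e [r [A [hA lA iA]]]; exists r, A; split=> // f; rewrite -e.
Qed.

Lemma has_lin_res0 d : has_lin_res d (fun f => f = 0).
Proof.
have h0 r : homog_mx 1 (0 : 'M[T]_(0, r)) by case.
have s0 r : syzygies (0 : 'M[T]_(0, r)) (0 : 'M_(0, 0)).
  by move=> u; rewrite mulmx0; split=> // _; exists 0; rewrite mulmx0; apply: thinmx0.
have l0 : forall r, lin_res (0 : 'M[T]_(0, r)).
  by cofix IH => r; apply: LinRes (h0 0%N) (s0 r) (IH 0%N).
exists 0, 0; split; [by case|exact: l0|] => f; split=> [->|[u]].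
  by exists 0; rewrite mulmx0 raddf0.
by rewrite mulmx0 => /matrixP /(_ 0 0); rewrite !mxE mulr1n.
Qed.

(** Here [Q] is the colon ideal [I : f], and [I + (f)] is an extension of [T/Q], shifted by [d], by
    [I]. The last entry of a syzygy of the enlarged generators ranges over [Q]; hence the block
    matrix made of the syzygies of [I] and the generators [B] of [Q], with [C'] writing [- B f] in
    the generators of [I]. *)
Lemma has_lin_res_step d (I Q : T -> Prop) f :
  f \is d.-homog -> has_lin_res d I -> has_lin_res 1 Q ->
  (forall v, I (v * f) <-> Q v) ->
  has_lin_res d (fun p => exists q v, I q /\ p = q + v * f).
Proof.
move=> hf [r [A [hA lA iA]]] [k [B [hB lB iB]]] colon.
have [r' [A' [hA' sA lA']]] := lin_res_next lA.
have hBf : homog_mx d.+1 (- (B *m f%:M)).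
  apply: homog_oppmx; rewrite -add1n; apply: homog_mulmx => // p q.
  by rewrite !mxE (ord1 p) (ord1 q) mulr1n.
have [C' eC hC'] : exists2 C', - (B *m f%:M) = C' *m A & homog_mx 1 C'.
  apply: (homog_mx_lift hBf hA); apply: rows_in_image => p.
  have /iA [w hw] : I (- B p 0 * f).
    apply/colon/iB; exists (- delta_mx 0 p); rewrite mulNmx -rowE.
    by apply/matrixP => i j; rewrite !mxE !ord1 mulr1n.
  exists w; rewrite -hw; apply/matrixP => i j; rewrite !mxE !ord1 big_ord1 !mxE.
  by rewrite !mulr1n mulNr.
have lBl : lin_res (block_mx A' 0 C' B).
  apply: lin_res_block hA' hC' _ lA' lB => v hv.
  have /sA [w hw] : (v *m C') *m A = 0.
    by rewrite -mulmxA -eC mulmxN mulmxA hv mul0mx oppr0.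
  by exists (- w); rewrite hw mulNmx addNr.
exists (r + 1)%N, (col_mx A f%:M); split.
- move=> p q; rewrite -(splitK p); case: (split p) => i /=; first by rewrite col_mxEu.
  by rewrite col_mxEd !mxE !ord1 mulr1n.
- apply: (LinRes (homog_block_mx hA' hC' hB) _ lBl) => u; split=> [|[w ->]].
    rewrite -[u]hsubmxK mul_row_col => hu.
    have [w2 e2] : exists w2, rsubmx u = w2 *m B.
      rewrite [rsubmx u]mx11_scalar; apply/iB/colon/iA; exists (- lsubmx u).
      move/eqP: hu; rewrite addr_eq0 => /eqP hu; rewrite mulNmx hu opprK.
      by rewrite scalar_mxM -mx11_scalar.
    have /sA [w1 e3] : (lsubmx u - w2 *m C') *m A = 0.
      by rewrite mulmxBl -mulmxA -eC mulmxN opprK mulmxA -e2.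
    exists (row_mx w1 w2); rewrite mul_row_block mulmx0 add0r -e2 -e3.
    by rewrite subrK.
  rewrite -mulmxA mul_block_col mul0mx addr0 (syzygies_mul0 sA) -eC addNr.
  by rewrite col_mx0 mulmx0.
- move=> p; split=> [[q [v [/iA [u hu] ->]]]|[u]].
    exists (row_mx u v%:M); rewrite mul_row_col -hu -scalar_mxM.
    by rewrite raddfD.
  rewrite -[u]hsubmxK mul_row_col => hp; exists ((lsubmx u *m A) 0 0), (rsubmx u 0 0).
  split; first by apply/iA; exists (lsubmx u); rewrite -mx11_scalar.
  have -> : p = (p%:M : 'M_1) 0 0 by rewrite mxE mulr1n.
  by rewrite hp mxE; congr (_ + _); rewrite mxE big_ord1 [f%:M _ _]mxE mulr1n.
Qed.

End Linear.

(** * Monomial ideals with linear quotients *)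

Section MonomialIdeal.
Variables (K : fieldType) (n : nat).
Local Notation T := {mpoly K[n]}.
Implicit Types (s : seq 'X_{1..n}) (p q : T).

(** Membership is read off from the support, which turns products, components and colon ideals into
    statements on exponents. By [monideal_ind] this is the ideal generated by the monomials in
    [s]. *)
Definition monideal s p : Prop :=
  {in msupp p, forall t, exists2 m, m \in s & (m <= t)%MM}.

Lemma monideal0 s : monideal s 0.
Proof. by move=> t; rewrite msupp0. Qed.

Lemma monidealD s p q : monideal s p -> monideal s q -> monideal s (p + q).
Proof. by move=> hp hq t /msuppD_le; rewrite mem_cat => /orP[/hp|/hq]. Qed.

Lemma monideal_sum s I (r : seq I) (P : pred I) (F : I -> T) :
  (forall i, P i -> monideal s (F i)) -> monideal s (\sum_(i <- r | P i) F i).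
Proof. by move=> h; apply: big_ind => //; [apply: monideal0|apply: monidealD]. Qed.

Lemma dvdm_add (m1 m2 t1 t2 : 'X_{1..n}) :
  (m1 <= t1)%MM -> (m2 <= t2)%MM -> (m1 + m2 <= t1 + t2)%MM.
Proof.
by move=> /mnm_lepP h1 /mnm_lepP h2; apply/mnm_lepP => i; rewrite !mnmDE leq_add.
Qed.

Lemma monidealMM s1 s2 s p q :
  (forall m1 m2, m1 \in s1 -> m2 \in s2 -> exists2 m, m \in s & (m <= m1 + m2)%MM) ->
  monideal s1 p -> monideal s2 q -> monideal s (p * q).
Proof.
move=> h hp hq t /msuppM_le /allpairsP [[t1 t2] /= [/hp [m1 h1 l1] /hq [m2 h2 l2] ->]].
have [m hm lm] := h _ _ h1 h2; exists m => //.
by apply: lepm_trans lm _; apply: dvdm_add.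
Qed.

Lemma monidealMl s c p : monideal s p -> monideal s (c * p).
Proof.
move=> hp; apply: (@monidealMM [:: 0%MM] s) hp; last first.
  by move=> t _; exists 0%MM; rewrite ?mem_seq1 //; apply/mnm_lepP => i; rewrite mnm0E.
by move=> m1 m2 _ h2; exists m2 => //; apply: lem_addl.
Qed.

Lemma monidealX s m : m \in s -> monideal s 'X_[m].
Proof. by move=> hm t /mem_msuppXP <-; exists m => //; apply: lepm_refl. Qed.

Lemma monideal_hcomp s e p : monideal s p -> monideal s (hcomp e p).
Proof.
move=> hp; rewrite [p]mpolyE linear_sum big_seq; apply: monideal_sum => t ht.
rewrite linearZ /= hcompX; case: ifP => _; last by rewrite scaler0; apply: monideal0.
move=> t' /msuppZ_le /mem_msuppXP <-; exact: hp.
Qed.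

Lemma monideal_homogeneous s : homogeneous_ideal (monideal s).
Proof.
split; [exact: monideal0|exact: monidealD|exact: monidealMl|exact: monideal_hcomp].
Qed.

Lemma monideal_ind (P : T -> Prop) s :
  P 0 -> (forall p q, P p -> P q -> P (p + q)) -> (forall c p, P p -> P (c * p)) ->
  {in s, forall m, P 'X_[m]} -> forall p, monideal s p -> P p.
Proof.
move=> P0 PD PM Ps p hp; rewrite [p]mpolyE big_seq; apply: big_ind => // t /hp [m hm le].
by rewrite -(submK le) mpolyXD scalerAl; apply/PM/Ps.
Qed.

Lemma monidealMX s m p :
  monideal s (p * 'X_[m]) <->
  {in msupp p, forall t, exists2 m', m' \in s & (m' <= m + t)%MM}.
Proof.
split=> h t; last first.
  by rewrite (perm_mem (msuppMX _ _)) => /mapP [t' /h h' ->].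
by move=> ht; apply: h; rewrite (perm_mem (msuppMX _ _)); apply: map_f.
Qed.

Lemma monideal_rcons s m p :
  monideal (rcons s m) p <-> exists q v, monideal s q /\ p = q + v * 'X_[m].
Proof.
split=> [|[q [v [hq ->]]]]; last first.
  apply: monidealD.
    by move=> t /hq [m' hm' le]; exists m' => //; rewrite mem_rcons inE hm' orbT.
  by apply/monidealMl/monidealX; rewrite mem_rcons mem_head.
move: p; apply: monideal_ind.
- by exists 0, 0; rewrite mul0r addr0; split=> //; apply: monideal0.
- move=> _ _ [q1 [v1 [h1 ->]]] [q2 [v2 [h2 ->]]]; exists (q1 + q2), (v1 + v2).
  by rewrite mulrDl addrACA; split=> //; apply: monidealD.
- move=> c _ [q [v [h ->]]]; exists (c * q), (c * v).
  by rewrite mulrDr mulrA; split=> //; apply: monidealMl.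
- move=> m'; rewrite mem_rcons inE => /predU1P [->|hm'].
    by exists 0, 1; rewrite mul1r add0r; split=> //; apply: monideal0.
  by exists 'X_[m'], 0; rewrite mul0r addr0; split=> //; apply: monidealX.
Qed.

Lemma monideal_step d s s' m :
  mdeg m = d -> has_lin_res d (monideal s) -> has_lin_res 1 (monideal s') ->
  (forall p, monideal s (p * 'X_[m]) <-> monideal s' p) ->
  has_lin_res d (monideal (rcons s m)).
Proof.
move=> hm hs hs' hc; have hX : 'X_[K, m] \is d.-homog by rewrite dhomogX; apply/eqP.
apply: has_lin_res_ext (has_lin_res_step hX hs hs' hc) => f.
by split=> /monideal_rcons.
Qed.

Lemma monideal_nil d : has_lin_res d (monideal [::]).
Proof.
apply: has_lin_res_ext (@has_lin_res0 K n d) => f; split=> [->|hf]; first exact: monideal0.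
apply/eqP; rewrite -msupp_eq0; case E: (msupp f) => [//|t r].
by have [] := hf t; rewrite ?E ?mem_head.
Qed.

Lemma lem1 i (t : 'X_{1..n}) : (U_(i) <= t)%MM = (0 < t i)%N.
Proof.
apply/mnm_lepP/idP => [/(_ i)|ht j]; first by rewrite mnm1E eqxx.
by rewrite mnm1E; case: eqP => // <-.
Qed.

(** This is the Koszul resolution, built variable by variable: the colon of the earlier variables by
    a new one is again the ideal of the earlier variables, so [hl] serves twice. *)
Lemma variables_lin_res (l : seq 'I_n) :
  uniq l -> has_lin_res 1 (monideal [seq U_(i)%MM | i <- l]).
Proof.
elim/last_ind: l => [_|l i IH]; first exact: monideal_nil.
rewrite rcons_uniq map_rcons => /andP [il /IH hl].
apply: (monideal_step (mdeg1 i) hl hl) => p; split=> [/monidealMX|] hp; last first.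
  by rewrite mulrC; apply: monidealMl.
move=> t /hp [_ /mapP [j hj ->]]; rewrite lem1 mnmDE mnm1E.
have /negPf -> : i != j by apply: contraNneq il => ->.
by rewrite -lem1 => le; exists U_(j)%MM => //; apply: map_f.
Qed.

(** If [f y] divides [t] times [f x], the variable [i] with larger exponent in [f y] than in [f x]
    divides [t]; by the condition on [z] it lies in the colon ideal. So this colon is generated by
    variables. *)
Lemma linear_quotients d (X : eqType) (f : X -> 'X_{1..n}) (l : seq X) :
  {in l, forall x, mdeg (f x) = d} ->
  (forall l1 x l2, l = l1 ++ x :: l2 -> forall y, y \in l1 ->
     exists i z, [/\ z \in l1, (f x i < f y i)%N & (f z <= f x + U_(i))%MM]) ->
  has_lin_res d (monideal (map f l)).
Proof.
elim/last_ind: l => [|l x IH] hd hq; first by move=> *; apply: monideal_nil.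
rewrite map_rcons.
pose vars := [seq i <- enum 'I_n | has (fun y => (f y <= f x + U_(i))%MM) l].
apply: (@monideal_step _ _ [seq U_(i)%MM | i <- vars]).
- by apply: hd; rewrite mem_rcons mem_head.
- apply: IH => [y hy|l1 y l2 e]; first by apply: hd; rewrite mem_rcons inE hy orbT.
  by apply: (hq l1 y (rcons l2 x)); rewrite e rcons_cat.
- by apply: variables_lin_res; rewrite filter_uniq ?enum_uniq.
move=> p; split=> [/monidealMX|] hp; last apply/monidealMX.
  move=> t /hp [_ /mapP [y hy ->] le].
  have [|i [z [hz lt lez]]] := hq l x [::] _ y hy; first by rewrite cats1.
  exists U_(i)%MM.
    by apply: map_f; rewrite mem_filter mem_enum andbT; apply/hasP; exists z.
  rewrite lem1; have := mnm_lepP le i; rewrite mnmDE => h.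
  by rewrite -(ltn_add2l (f x i)) addn0; apply: leq_trans lt h.
move=> t /hp [_ /mapP [i + ->] le]; rewrite mem_filter => /andP [/hasP [y hy ley] _].
exists (f y); first exact: map_f.
by apply: lepm_trans ley _; apply: dvdm_add => //; apply: lepm_refl.
Qed.

End MonomialIdeal.

(** * Exchange property *)

Section Meets.
Variables (n z : nat).
Implicit Types (V A B : {set 'I_n}).

Definition meets_both V A : bool :=
  [&& #|A| == z, A :&: V != set0 & A :&: ~: V != set0].

Lemma meets_bothC V A : meets_both (~: V) A = meets_both V A.
Proof. by rewrite /meets_both setCK [X in _ && X]andbC. Qed.

(** By symmetry the incoming [i] lies in [V], so the new set meets [V], and it remains to keep an
    element of [A] outside [V]. Removing [j] from [V] does so; such a [j] is missing only if
    [A :&: V] is contained in [B]. *)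
Lemma meets_both_exchange V A B i :
  meets_both V A -> meets_both V B -> i \in B -> i \notin A ->
  exists j, [/\ j \in A, j \notin B & meets_both V (i |: (A :\ j))].
Proof.
wlog iV : V / i \in V.
  move=> h; case: (boolP (i \in V)) => [|iV]; first exact: h.
  rewrite -(meets_bothC V A) -(meets_bothC V B) => hA hB iB iA.
  have [|j [jA jB hj]] := h _ _ hA hB iB iA; first by rewrite inE.
  by exists j; rewrite -meets_bothC.
case/and3P => /eqP cA /set0Pn [v /setIP [vA vV]] /set0Pn [k /setIP [kA kV]].
case/and3P => /eqP cB _ /set0Pn [k' /setIP [kB' kV']] iB iA.
have cardS j : j \in A -> #|i |: (A :\ j)| = z.
  by move=> jA; rewrite cardsU1 !inE (negPf iA) andbF -cA (cardsD1 j A) jA.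
have goodS j k0 : j \in A -> k0 \in A -> k0 \notin V -> k0 != j -> meets_both V (i |: (A :\ j)).
  move=> jA k0A k0V ne; rewrite /meets_both cardS // eqxx /=; apply/andP; split.
    by apply/set0Pn; exists i; rewrite !inE eqxx iV.
  by apply/set0Pn; exists k0; rewrite !inE ne k0A k0V orbT.
have [/existsP [j /and3P [jA jB jV]]|none] := boolP [exists j, [&& j \in A, j \notin B & j \in V]].
  exists j; split => //; apply: goodS kA _ _ => //; first by rewrite inE in kV.
  by apply: contraTneq kV => ->; rewrite inE negbK.
have AVB x : x \in A -> x \in V -> x \in B.
  move=> xA xV; apply: contraNT none => xB; apply/existsP; exists x.
  by rewrite xA xB.
have /subsetPn [j jA jB] : ~~ (A \subset B).
  apply/negP => sAB; have /eqP e : A == B by rewrite eqEcard sAB cA cB leqnn.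
  by rewrite e iB in iA.
exists j; split => //.
have [/existsP [x /and3P [xA xV ne]]|none'] := boolP [exists x, [&& x \in A, x \notin V & x != j]].
  exact: goodS jA xA xV ne.
(* Now [j] is the only element of [A] outside [V]. The new set then lies in [V] and in [B], so by
   cardinality it is [B], which contains [k'] outside [V]. *)
have sV : i |: (A :\ j) \subset V.
  apply/subsetP => x; rewrite !inE => /predU1P [->//|/andP [ne xA]].
  by apply: contraNT none' => xV; apply/existsP; exists x; rewrite xA xV.
have sB : i |: (A :\ j) \subset B.
  apply/subsetP => x; rewrite !inE => /predU1P [->//|/andP [ne xA]].
  by apply: AVB => //; apply: (subsetP sV); rewrite !inE ne xA orbT.
have /eqP e : i |: (A :\ j) == B by rewrite eqEcard sB cardS // cB leqnn.
by move: kB'; rewrite -e => /(subsetP sV); rewrite inE in kV'; rewrite (negPf kV').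
Qed.

(* Weight whose order is the lexicographic one, comparing largest elements first. *)
Definition weight A : nat := (\sum_(i in A) 2 ^ i)%N.

Lemma weight_lt A (i : 'I_n) : (forall k, k \in A -> (k < i)%N) -> (weight A < 2 ^ i)%N.
Proof.
move=> h; apply: (@leq_ltn_trans (\sum_(k < i) 2 ^ k)%N).
  rewrite (big_ord_widen n (fun k => 2 ^ k)%N (ltnW (ltn_ord i))) /weight.
  rewrite big_mkcond [leqRHS]big_mkcond; apply: leq_sum => k _.
  by case: ifP => // /h ->.
have := predn_exp 2 i; rewrite mul1n => <-.
by rewrite prednK ?expn_gt0.
Qed.

(** The witness is the largest element of the symmetric difference. Were it in [A], the term [2 ^ i]
    alone would outweigh all of [B :\: A], whose elements are below [i]. *)
Lemma weight_max_diff A B :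
  A != B -> (weight A <= weight B)%N ->
  exists i, [/\ i \in B, i \notin A & forall k, k \in A -> k \notin B -> (k < i)%N].
Proof.
move=> ne le; pose D := (A :\: B) :|: (B :\: A).
have [i0 i0D] : exists i, i \in D.
  apply/set0Pn; apply: contra ne; rewrite setU_eq0 !setD_eq0 => /andP [h1 h2].
  by rewrite eqEsubset h1.
case: (@arg_maxnP _ i0 (mem D) val i0D) => i /= iD imax.
have imax' k : k \in D -> k != i -> (k < i)%N.
  by move=> /imax /= h ne'; rewrite ltn_neqAle h andbT.
case: (boolP (i \in B)) => iB.
  exists i; split=> [//||k kA kB]; first by move: iD; rewrite !inE iB andbT.
  apply: imax'; first by rewrite !inE kA kB.
  by apply: contraNneq kB => ->.
have iA : i \in A by move: iD; rewrite !inE (negPf iB) andbF orbF.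
have lt : (weight (B :\: A) < 2 ^ i)%N.
  apply: weight_lt => k; rewrite inE => /andP [kA kB].
  by apply: imax'; [rewrite !inE kA kB orbT|apply: contraNneq kA => ->].
have ge : (2 ^ i <= weight (A :\: B))%N.
  by rewrite /weight (bigD1 i) ?inE ?iA ?iB //= leq_addr.
move: le; rewrite leqNgt => /negP [].
rewrite /weight (big_setID A) [X in (_ < X)%N](big_setID B) /= setIC ltn_add2l.
exact: leq_trans lt ge.
Qed.

Lemma weight_exchange A (i j : 'I_n) :
  j \in A -> i \notin A -> (j < i)%N -> (weight A < weight (i |: (A :\ j)))%N.
Proof.
move=> jA iA lt; rewrite /weight (bigD1 j) //= [ltnRHS]big_setU1 /=; last first.
  by rewrite !inE (negPf iA) andbF.
rewrite -[X in (X < _)%N]addn0 -addnA.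
have -> : (\sum_(k in A :\ j) 2 ^ k = \sum_(k in A | k != j) 2 ^ k)%N.
  by apply: eq_bigl => k; rewrite !inE andbC.
by rewrite addn0 ltn_add2r ltn_exp2l.
Qed.

(** Heavier sets come first, so an exchange that raises the weight leads back to an earlier set. *)
Definition lex_enum V : seq {set 'I_n} :=
  sort (fun A B => weight B <= weight A)%N (enum [set A | meets_both V A]).

Lemma mem_lex_enum V A : (A \in lex_enum V) = meets_both V A.
Proof. by rewrite mem_sort mem_enum inE. Qed.

Lemma lex_enum_split V l1 A l2 : lex_enum V = l1 ++ A :: l2 ->
  (forall B, B \in l1 -> B != A /\ (weight A <= weight B)%N) /\
  (forall B, meets_both V B -> (weight A < weight B)%N -> B \in l1).
Proof.
move=> e.
have tr : transitive (fun A B => weight B <= weight A)%N.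
  by move=> x y w /= h1 h2; apply: leq_trans h2 h1.
have : sorted (fun A B => weight B <= weight A)%N (lex_enum V).
  by apply: sort_sorted => x y; apply: leq_total.
rewrite sorted_pairwise // e pairwise_cat /= => /and3P [/allrelP h1 _ /andP [/allP h2 _]].
have : uniq (lex_enum V) by rewrite sort_uniq enum_uniq.
rewrite e cat_uniq /= negb_or => /and3P [_ /andP [nA _] _].
split=> B.
  move=> Bl; split; first by apply: contraNneq nA => <-.
  by apply: h1 => //; apply: mem_head.
rewrite -mem_lex_enum e mem_cat inE => /or3P [//|/eqP ->|/h2 /= h]; first by rewrite ltnn.
by rewrite ltnNge h.
Qed.

Definition mset A : 'X_{1..n} := [multinom (i \in A : nat) | i < n].

Lemma msetE A i : mset A i = (i \in A). Proof. exact: mnmE. Qed.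

Lemma mdeg_mset A : mdeg (mset A) = #|A|.
Proof.
rewrite mdegE -sum1_card [RHS]big_mkcond; apply: eq_bigr => i _.
by rewrite msetE; case: (i \in A).
Qed.

Lemma prod_mpolyX (K : fieldType) A : \prod_(i in A) 'X_i = 'X_[mset A] :> {mpoly K[n]}.
Proof.
rewrite mpolyXE_id big_mkcond; apply: eq_bigr => i _.
by rewrite msetE; case: (i \in A); rewrite ?expr1 ?expr0.
Qed.

(** For [B] before [A], bring into [A] the largest element [i] of their difference, which lies in
    [B]. The element [j] exchanged for it is in [A] but not in [B], hence below [i]; the new set is
    heavier, so it precedes [A], and its monomial divides [x_i] times that of [A]. *)
Lemma meets_both_lin_res (K : fieldType) V :
  has_lin_res z (@monideal K n [seq mset A | A <- lex_enum V]).
Proof.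
apply: linear_quotients => [A|l1 A l2 e B Bl].
  by rewrite mem_lex_enum mdeg_mset => /and3P [/eqP].
have [h1 h2] := lex_enum_split e.
have mA : meets_both V A by rewrite -mem_lex_enum e mem_cat mem_head orbT.
have mB : meets_both V B by rewrite -mem_lex_enum e mem_cat Bl.
have [ne le] := h1 _ Bl; rewrite eq_sym in ne.
have [i [iB iA imax]] := weight_max_diff ne le.
have [j [jA jB mC]] := meets_both_exchange mA mB iB iA.
exists i, (i |: (A :\ j)); split.
- by apply: h2 => //; apply: weight_exchange => //; apply: imax.
- by rewrite !msetE iB (negPf iA).
- apply/mnm_lepP => k; rewrite mnmDE mnm1E !msetE !inE (eq_sym i).
  by case: (k == i); case: (k \in A); case: (k == j).
Qed.

End Meets.

(** * The mixed product ideal *)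

Section IdealClosure.
Variable R : comNzRingType.
Implicit Types (S I P : R -> Prop).

Definition ideal_closed P : Prop :=
  [/\ P 0, forall x y, P x -> P y -> P (x + y) & forall c x, P x -> P (c * x)].

Lemma ideal_gen_sub S P :
  ideal_closed P -> (forall x, S x -> P x) -> forall x, ideal_gen S x -> P x.
Proof.
case=> P0 PD PM SP x [k [c [s [hs ->]]]].
by apply: big_ind => // i _; apply/PM/SP.
Qed.

Lemma ideal_gen_mem S x : S x -> ideal_gen S x.
Proof.
by move=> Sx; exists 1%N, (fun=> 1), (fun=> x); split=> //; rewrite big_ord1 mul1r.
Qed.

Lemma ideal_gen_closed S : ideal_closed (ideal_gen S).
Proof.
split.
- exists 0%N, (fun=> 0), (fun=> 0); split; first by case.
  by rewrite big_ord0.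
- move=> _ _ [k1 [c1 [s1 [h1 ->]]]] [k2 [c2 [s2 [h2 ->]]]].
  pose glue (f : 'I_k1 -> R) (g : 'I_k2 -> R) i :=
    match split i with inl j => f j | inr j => g j end.
  exists (k1 + k2)%N, (glue c1 c2), (glue s1 s2); split.
    by move=> i; rewrite /glue; case: (split i).
  rewrite big_split_ord /=; congr (_ + _); apply: eq_bigr => i _.
    by rewrite /glue -[lshift _ _]/(unsplit (inl i)) unsplitK.
  by rewrite /glue -[rshift _ _]/(unsplit (inr i)) unsplitK.
- move=> d _ [k [c [s [h ->]]]]; exists k, (fun i => d * c i), s; split=> //.
  by rewrite mulr_sumr; apply: eq_bigr => i _; rewrite mulrA.
Qed.

Lemma ideal_sum_closed m (I : nat -> R -> Prop) :
  (forall j, ideal_closed (I j)) -> ideal_closed (ideal_sum m I).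
Proof.
move=> h; split.
- by exists (fun=> 0); split=> [j _|]; [case: (h j)|rewrite big1].
- move=> _ _ [s [hs ->]] [t [ht ->]]; exists (fun j => s j + t j).
  rewrite big_split; split=> // j hj; case: (h j) => _ hD _.
  by apply: hD; [apply: hs|apply: ht].
- move=> c _ [s [hs ->]]; exists (fun j => c * s j); rewrite mulr_sumr.
  by split=> // j hj; case: (h j) => _ _; apply; apply: hs.
Qed.

Lemma ideal_sum_mem m (I : nat -> R -> Prop) j x :
  (forall j, ideal_closed (I j)) -> (1 <= j <= m)%N -> I j x -> ideal_sum m I x.
Proof.
move=> h hj Ix; exists (fun k => if k == j then x else 0); split=> [k _|].
  by case: eqP => [->//|_]; case: (h k).
rewrite (bigD1_seq j) ?mem_index_iota ?iota_uniq //= eqxx big1 ?addr0 // => k.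
by move=> /negPf ->.
Qed.

End IdealClosure.

Section Identification.
Variable K : fieldType.

Lemma monideal_closed n s : ideal_closed (@monideal K n s).
Proof. by have [] := @monideal_homogeneous K n s. Qed.

Lemma subst_prodX k n (g : 'I_k -> 'I_n) (A : {set 'I_k}) : injective g ->
  (\prod_(i in A) 'X_i : {mpoly K[k]}) \mPo [tuple 'X_(g i) | i < k] = 'X_[mset (g @: A)].
Proof.
move=> gI; rewrite rmorph_prod -prod_mpolyX big_imset; last by move=> ? ? _ _; apply: gI.
by apply: eq_bigr => i _; rewrite /= comp_mpolyXU -tnth_nth tnth_mktuple.
Qed.

Lemma ext_veronese_sub k n (g : 'I_k -> 'I_n) a x : injective g ->
  ideal_ext (fun p => p \mPo [tuple 'X_(g i) | i < k]) (@sqfree_veronese K k a) x ->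
  monideal [seq mset (g @: A) | A : {set 'I_k} <- enum [set A : {set 'I_k} | #|A| == a]] x.
Proof.
move=> gI; apply: ideal_gen_sub; first exact: monideal_closed.
move=> _ [p [r [c [s [hs ->]]]] ->]; rewrite rmorph_sum; apply: monideal_sum => i _.
rewrite rmorphM; apply: monidealMl; case: (hs i) => A cA -> /=.
by rewrite subst_prodX //; apply/monidealX/map_f; rewrite mem_enum inE cA.
Qed.

Lemma ext_veronese_mem k n (g : 'I_k -> 'I_n) (A : {set 'I_k}) : injective g ->
  ideal_ext (fun p => p \mPo [tuple 'X_(g i) | i < k]) (@sqfree_veronese K k #|A|)
    'X_[mset (g @: A)].
Proof.
move=> gI; apply: ideal_gen_mem; exists (\prod_(i in A) 'X_i); last by rewrite subst_prodX.
by apply: ideal_gen_mem; exists A.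
Qed.

Variables m1 m2 : nat.

Definition block1 : {set 'I_(m1 + m2)} := [set lshift m2 i | i : 'I_m1].

Lemma lshift_block1 i : lshift m2 i \in block1.
Proof. exact: imset_f. Qed.

Lemma rshift_block1 i : (rshift m1 i \in block1) = false.
Proof. by apply/negP => /imsetP [j _ /eqP]; rewrite eq_rlshift. Qed.

Lemma mset_shift (A1 : {set 'I_m1}) (A2 : {set 'I_m2}) :
  mset (lshift m2 @: A1 :|: @rshift m1 m2 @: A2) =
  (mset (lshift m2 @: A1) + mset (@rshift m1 m2 @: A2))%MM.
Proof.
apply/mnmP => i; rewrite mnmDE !msetE inE.
case: imsetP => [[j _ ->]|_]; last by rewrite add0n.
case: imsetP => // [[j' _ /eqP]]; by rewrite eq_lrshift.
Qed.

Lemma shift_preim (A : {set 'I_(m1 + m2)}) :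
  A = lshift m2 @: (lshift m2 @^-1: A) :|: @rshift m1 m2 @: (@rshift m1 m2 @^-1: A).
Proof.
apply/setP => i; rewrite inE; apply/idP/orP.
  rewrite -(splitK i); case: (split i) => j /= hA; [left|right]; apply: imset_f;
    by rewrite inE.
by case=> /imsetP [j]; rewrite inE => ? ->.
Qed.

Lemma card_shift (A1 : {set 'I_m1}) (A2 : {set 'I_m2}) :
  #|lshift m2 @: A1 :|: @rshift m1 m2 @: A2| = (#|A1| + #|A2|)%N.
Proof.
rewrite -[LHS]mdeg_mset mset_shift mdegD !mdeg_mset !card_imset //.
  exact: rshift_inj.
exact: lshift_inj.
Qed.

Lemma meets_both_shift z (A1 : {set 'I_m1}) (A2 : {set 'I_m2}) :
  meets_both z block1 (lshift m2 @: A1 :|: @rshift m1 m2 @: A2) =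
  [&& (#|A1| + #|A2|)%N == z, (0 < #|A1|)%N & (0 < #|A2|)%N].
Proof.
rewrite /meets_both card_shift !card_gt0; congr [&& _, _ & _].
  apply/set0Pn/set0Pn => [[x]|[i iA]].
    rewrite !inE => /andP [/orP [/imsetP [i iA _]|/imsetP [i _ ->]]]; first by exists i.
    by rewrite rshift_block1.
  by exists (lshift m2 i); rewrite !inE imset_f // lshift_block1.
apply/set0Pn/set0Pn => [[x]|[i iA]].
  rewrite !inE => /andP [/orP [/imsetP [i _ ->]|/imsetP [i iA _]]]; last by exists i.
  by rewrite lshift_block1.
by exists (rshift m1 i); rewrite !inE [X in _ || X]imset_f ?orbT // rshift_block1.
Qed.

(** A support with parts [A1] and [A2] in the two groups belongs to the summand [j = #|A1|]: as [A2]
    is nonempty, [j <= z - 1 = m], and [b j = z - j = #|A2|]. Conversely [1 <= j <= m] makes both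
    parts nonempty. *)
Lemma mixed_product_idealE z m (a b : nat -> nat) :
  (forall j, (1 <= j <= m)%N -> a j = j) ->
  (forall j, (1 <= j <= m)%N -> (a j + b j = z)%N) -> z = m.+1 ->
  forall p, @mixed_product_ideal K m1 m2 m a b p <->
    @monideal K _ [seq mset A | A <- lex_enum z block1] p.
Proof.
move=> ha hab hz p.
have cl j := @ideal_gen_closed {mpoly K[m1 + m2]} (fun z =>
  exists x y, [/\ ideal_ext (@incl1 K m1 m2) (@sqfree_veronese K m1 (a j)) x,
    ideal_ext (@incl2 K m1 m2) (@sqfree_veronese K m2 (b j)) y & z = x * y]).
split=> [[s [hs ->]]|].
  rewrite big_nat; apply: monideal_sum => j; rewrite ltnS => hj.
  apply: (ideal_gen_sub (monideal_closed _) _ (hs j hj)) => _ [x [y [hx hy ->]]].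
  apply: monidealMM (ext_veronese_sub (@lshift_inj _ _) hx) (ext_veronese_sub (@rshift_inj _ _) hy).
  move=> _ _ /mapP [A1 + ->] /mapP [A2 + ->]; rewrite !mem_enum !inE => /eqP c1 /eqP c2.
  rewrite -mset_shift; eexists; last exact: lepm_refl.
  apply: map_f; rewrite mem_lex_enum meets_both_shift c1 c2 hab // eqxx /=.
  by have := hab j hj; rewrite ha //; lia.
have [L0 LD LM] := ideal_sum_closed m cl.
apply: monideal_ind => // _ /mapP [A + ->]; rewrite mem_lex_enum (shift_preim A).
move: (lshift m2 @^-1: A) (@rshift m1 m2 @^-1: A) => A1 A2.
rewrite meets_both_shift => /and3P [/eqP cz c1 c2]; rewrite mset_shift mpolyXD.
have hj : (1 <= #|A1| <= m)%N by rewrite c1 -ltnS -hz -cz -[ltnLHS]addn0 ltn_add2l.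
apply: (ideal_sum_mem cl hj); apply: ideal_gen_mem.
exists 'X_[mset (lshift m2 @: A1)], 'X_[mset (@rshift m1 m2 @: A2)]; split=> //.
  by rewrite ha //; apply: ext_veronese_mem (@lshift_inj _ _).
have -> : b #|A1| = #|A2| by apply: (@addnI #|A1|); rewrite cz -(hab _ hj) ha.
exact: ext_veronese_mem (@rshift_inj _ _).
Qed.

End Identification.

(** * The free complex extracted from coinductive linearity *)

Section LinearResolution.
Variables (K : fieldType) (n : nat).
Local Notation T := {mpoly K[n]}.

Record lin_stage := LinStage {
  stage_rows : nat; stage_cols : nat;
  stage_mx : 'M[T]_(stage_rows, stage_cols);
  stage_lin : lin_res stage_mx }.

(** The type of [next_mx] makes the columns of the next stage convertible to the rows of the present
    one, so iterated stages compose without casts. *)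
Record lin_next (S : lin_stage) := LinNext {
  next_rows : nat;
  next_mx : 'M[T]_(next_rows, stage_rows S);
  next_homog : homog_mx 1 next_mx;
  next_syz : syzygies (stage_mx S) next_mx;
  next_lin : lin_res next_mx }.

Lemma lin_next_exists S : exists _ : lin_next S, True.
Proof.
case: S => r s A lA; have [r' [B [hB sB lB]]] := lin_res_next lA.
by exists (@LinNext (LinStage lA) r' B hB sB lB).
Qed.

(** A complex is data whereas [lin_res] is a proposition, hence the appeal to description. *)
Definition choose_next S : lin_next S :=
  proj1_sig (constructive_indefinite_description _ (lin_next_exists S)).

Definition succ_stage S : lin_stage := LinStage (next_lin (choose_next S)).

Variables (d r : nat) (A : 'M[T]_(r, 1)).
Hypotheses (hA : homog_mx d.+1 A) (lA : lin_res A).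

Definition res_stage i : lin_stage := iter i succ_stage (LinStage lA).

(** Position 0 is [T] with augmentation 1, and the generators of [L] form the first differential.
    Their degree is written [d.+1] so that this differential has no constant terms. *)
Definition linear_resolution : free_cplx K n :=
  @FreeCplx K n (fun i => stage_cols (res_stage i))
    (fun i _ => if i is k.+1 then (d.+1 + k)%:Z else 0)
    (fun i => stage_mx (res_stage i)) 1%:M.

Lemma linear_resolution_homog i :
  homog_mx (if i is 0 then d.+1 else 1) (fr_diff linear_resolution i).
Proof. by case: i => [|i] //; apply: next_homog. Qed.

Lemma linear_resolution_minimal (L : T -> Prop) : ideal_closed L ->
  (forall f, L f <-> exists u : 'rV_r, f%:M = u *m A) ->
  minimal_graded_free_resolution L linear_resolution.
Proof.
move=> [L0 _ _] LA; have hh := linear_resolution_homog; split; [split|split|].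
- by move=> p; rewrite !mxE (ord1 p) /= mulr1n dhomog1.
- move=> i p q; have := hh i p q; case: i p q => [|i] p q /=; first by rewrite ?addn0.
  by rewrite addnS -[X in X%:Z - _]addn1 PoszD addrAC subrr add0r.
- move=> f; exists f%:M; rewrite mulmx1 mxE subrr; exact: L0.
- move=> u; rewrite mulmx1 LA -mx11_scalar; split=> -[w e]; by exists w.
- by move=> i u; apply: next_syz.
- move=> i p q; apply: dhomog_nemf_coeff (hh i p q) _; rewrite /= [mdeg _]mdeg0; by case: i {p q}.
Qed.

End LinearResolution.

(** * Regularity *)

Section Regularity.
Variables (K : fieldType) (n : nat).
Local Notation T := {mpoly K[n]}.

Lemma resolution_ext (L L' : T -> Prop) (F : free_cplx K n) :
  (forall p, L p <-> L' p) ->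
  minimal_graded_free_resolution L F -> minimal_graded_free_resolution L' F.
Proof.
move=> e [gF [r1 r2 r3] mF]; split=> //; split=> // [f|u]; last by rewrite -e.
by have [u hu] := r1 f; exists u; apply/e.
Qed.

Lemma CM_regularity_ext (L L' : T -> Prop) r :
  (forall p, L p <-> L' p) -> CM_regularity L r -> CM_regularity L' r.
Proof.
move=> e [[F hF] h]; split; first by exists F; apply: resolution_ext e hF.
by move=> G hG; apply: h; apply: resolution_ext hG => p; rewrite e.
Qed.

Lemma graded_bettiP (F : free_cplx K n) i j :
  graded_betti F i j <> 0%N <-> exists p : 'I_(fr_rank F i), fr_shift p = j.
Proof.
split=> [/eqP|[p hp]]; last by apply/eqP; rewrite cards_eq0; apply/set0Pn; exists p; rewrite inE hp.
by rewrite cards_eq0 => /set0Pn [p]; rewrite inE => /eqP; exists p.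
Qed.

(** In the linear resolution, shift minus position is 0 at position 0 and [d] afterwards. The
    nonzero [f] ensures that position 1 is inhabited, so that [d] is attained. *)
Lemma CM_regularity_linear (L : T -> Prop) d f :
  homogeneous_ideal L -> has_lin_res d.+1 L -> L f -> f != 0 ->
  CM_regularity L d%:Z.
Proof.
move=> hL [r [A [hA lA LA]]] Lf f0.
have clL : ideal_closed L by case: hL.
have hG := linear_resolution_minimal hA lA clL LA.
have r0 : (0 < r)%N.
  rewrite lt0n; apply: contra_neq f0 => r0; have [u hu] := (LA f).1 Lf.
  have -> : f = (f%:M : 'M_1) 0 0 by rewrite mxE mulr1n.
  by rewrite hu mxE big1 // => i; have := ltn_ord i; rewrite [X in (_ < X)%N]r0.
split=> [|F hF]; first by exists (linear_resolution d lA).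
split=> [|i j /graded_bettiP [p <-]].
  have [q hq] := minimal_resolution_shift hL hG hF (i := 1) (Ordinal r0).
  exists 1%N, d.+1%:Z; split; last by rewrite -addn1 PoszD addrK.
  by apply/graded_bettiP; exists q; rewrite -hq /= addn0.
have [q ->] := minimal_resolution_shift hL hF hG p.
by case: i p q => [|k] p q /=; lia.
Qed.

End Regularity.

Lemma meets_both_nonempty m1 m2 z :
  (1 < m1)%N -> (1 < m2)%N -> (2 < z)%N -> (z <= m1 + m2 - 1)%N ->
  exists A, meets_both z (block1 m1 m2) A.
Proof.
(* Take [j] variables of the first group and [z - j] of the second: the bound [z.-1] leaves at least
   one for the second group, and if [j = m1] the bound on [z] gives [z - j <= m2]. *)
move=> h1 h2 hz2 hz; pose j := minn m1 z.-1.
have j1 : (j <= m1)%N by lia.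
have j2 : (z - j <= m2)%N by lia.
exists (lshift m2 @: (widen_ord j1 @: [set: 'I_j])
  :|: @rshift m1 m2 @: (widen_ord j2 @: [set: 'I_(z - j)])).
rewrite meets_both_shift !card_imset ?cardsT ?card_ord; first by lia.
all: by move=> x y /(congr1 val) /= e; apply: val_inj.
Qed.

Theorem theorem3p7 (K : fieldType) (m1 m2 m z : nat) (a b : nat -> nat)
  (hm1 : (1 < m1)%N) (hm2 : (1 < m2)%N) (hm : (1 < m)%N)
  (ha : forall j, (1 <= j < m)%N -> (a j < a j.+1)%N) (ha1 : a 1%N = 1%N)
  (hb : forall j, (1 <= j < m)%N -> (b j.+1 < b j)%N) (hbm : b m = 1%N)
  (hastep : forall j, (1 <= j <= m - 1)%N -> a j.+1 = (a j + 1)%N)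
  (hbstep : forall j, (2 <= j <= m)%N -> b (j - 1)%N = (b j + 1)%N)
  (hz2 : (2 < z)%N) (hz : (z <= m1 + m2 - 1)%N)
  (hab : forall j, (1 <= j <= m)%N -> (a j + b j = z)%N) :
  CM_regularity (@mixed_product_ideal K m1 m2 m a b) (z%:Z - 1).
Proof.
have aE j : (1 <= j <= m)%N -> a j = j.
  elim: j => [//|[|j] IH] hj //; rewrite hastep; last by lia.
  by rewrite IH ?addn1 //; lia.
(* Evaluate [a_j + b_j = z] at [j = m], where [a_m = m] and [b_m = 1]. *)
have zE : z = m.+1.
  by rewrite -(hab m) ?hbm ?aE ?addn1 //; lia.
have [A hA] := meets_both_nonempty hm1 hm2 hz2 hz.
have -> : z%:Z - 1 = m%:Z by rewrite zE -addn1 PoszD addrK.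
apply: (CM_regularity_ext (fun p => iff_sym (mixed_product_idealE aE hab zE p))).
have hX : @monideal K _ [seq mset B | B <- lex_enum z (block1 m1 m2)] 'X_[mset A].
  by apply/monidealX/map_f; rewrite mem_lex_enum.
apply: CM_regularity_linear hX _; first exact: monideal_homogeneous.
  by rewrite -zE; apply: meets_both_lin_res.
by rewrite -msupp_eq0 msuppX.
Qed.
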